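(* Let $S$ be a semigroup. Then the following statements are equivalent: (i) $\pi(S) \subseteq \{1,2\}$; (ii) the enhanced power graph $\mathcal{P}_e(S)$ is an acyclic graph; (iii) the enhanced power graph $\mathcal{P}_e(S)$ is bipartite.
   Context: For $z \in S$, $\langle z \rangle = \{z^m : m \geq 1\}$ is the subsemigroup generated by $z$, and the order of $z$ is $o(z) = |\langle z \rangle|$ (possibly infinite). $\pi(S) = \{o(a) : a \in S\}$ is the set of orders of all elements of $S$. The enhanced power graph $\mathcal{P}_e(S)$ of a semigroup $S$ is the simple undirected graph with vertex set $S$ in which two distinct vertices $x, y$ are adjacent if and only if $x, y \in \langle z \rangle$ for some $z \in S$. A graph is bipartite if its vertex set is the union of two disjoint independent sets (sets of pairwise non-adjacent vertices). *)

(* Defs.v *)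
From mathcomp Require Import all_boot finmap.
From mathcomp Require Import boolp classical_sets functions cardinality.

Set Implicit Arguments.
Unset Strict Implicit.
Unset Printing Implicit Defensive.

Local Open Scope classical_set_scope.

(* Adjacency is boolean so that path.v applies; with [boolp] any Prop-valued
   relation can be used through [asbool]. *)
Record simple_graph (V : choiceType) := SimpleGraph {
  adj :> rel V;
  adj_sym : symmetric adj;
  adj_irr : irreflexive adj }.

Section Graphs.
Variables (V : choiceType) (G : simple_graph V).

(* The vertices of a cycle c are pairwise distinct, consecutive ones are
   adjacent, and so are the last and the first. The bound on the size is needed
   because [ucycle] also accepts [::] and [:: x; y] with x and y adjacent. *)
Definition is_cycle (c : seq V) := 2 < size c /\ ucycle G c.

Definition acyclic := forall c : seq V, ~ is_cycle c.

Definition independent (A : set V) := forall x y, A x -> A y -> ~~ G x y.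

Definition bipartite := exists A B : set V,
  [/\ A `|` B = [set: V], A `&` B = set0, independent A & independent B].

End Graphs.

(* A [semigroupType] is a [choiceType]; since [boolp] equips every type with a
   choice structure, this covers all semigroups. *)
Section Semigroups.
Variable S : semigroupType.
Implicit Types x y z : S.

(* [natexp] needs a unit element for its value at 0. Here m is meant to be
   positive, and the value at 0 is a dummy. *)
Definition spow z (m : nat) : S := iterop m *%g z z.

Definition subsemigroup_gen z : set S := [set spow z m | m in [set m | 0 < m]].

(* [None] stands for infinite order. *)
Definition elt_order z : option nat :=
  if pselect (finite_set (subsemigroup_gen z))
  then Some #|` fset_set (subsemigroup_gen z) | else None.

Definition elt_orders : set (option nat) := range elt_order.

Definition enhanced_adj : rel S := fun x y =>
  (x != y) && `[< exists z, subsemigroup_gen z x /\ subsemigroup_gen z y >].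

Lemma enhanced_adj_sym : symmetric enhanced_adj.
Proof.
move=> x y; rewrite /enhanced_adj eq_sym; congr (_ && _).
by apply/asboolP/asboolP => -[z [zx zy]]; exists z.
Qed.

Lemma enhanced_adj_irr : irreflexive enhanced_adj.
Proof. by move=> x; rewrite /enhanced_adj eqxx. Qed.

Definition enhanced_power_graph : simple_graph S :=
  SimpleGraph enhanced_adj_sym enhanced_adj_irr.

End Semigroups.

Arguments elt_orders S : clear implicits.
Arguments enhanced_power_graph S : clear implicits.

(* Main.v *)
Require Import Defs.
From mathcomp Require Import all_boot finmap.
From mathcomp Require Import boolp classical_sets cardinality.

Local Open Scope classical_set_scope.

(** Each of (i), (ii), (iii) is equivalent to: for every [z], two of [z], [z^2],
    [z^3] coincide. Otherwise these three powers form a triangle, which is a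
    cycle of odd length, and [z] has order at least 3. Conversely, if two of them
    coincide then [<z> = {z, z^2}] with [z^2] idempotent, so every edge of the
    enhanced power graph joins a non-idempotent [x] to the idempotent [x^2]. The
    graph is then a disjoint union of stars centred at idempotents. *)

Section Collapsing.
Variable S : semigroupType.
Implicit Types x y z : S.

Local Notation "z ^2" := (z * z)%g (at level 2, format "z ^2").
Local Notation "z ^3" := (z * z ^2)%g (at level 2, format "z ^3").

(** Phrased through [uniq] because the negation then serves twice: for comparing cardinalities and
    for the distinct vertices of a triangle. *)
Definition collapsing z := ~~ uniq [:: z; z ^2; z ^3].

Definition idempotent z := z ^2 == z.

Lemma collapsingP z : collapsing z -> z ^3 = z \/ z ^3 = z ^2.
Proof.
rewrite /collapsing /= !inE andbT negb_and !negbK -orbA.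
(* The case [z = z ^2] is absorbed into the first alternative. *)
by case/or3P=> /eqP e; [left; rewrite -!e | left | right].
Qed.

Lemma subsemigroup_gen3 z :
  [/\ subsemigroup_gen z z, subsemigroup_gen z z ^2
    & subsemigroup_gen z z ^3].
Proof. by split; [exists 1 | exists 2 | exists 3]. Qed.

Lemma collapsing_gen z :
  collapsing z -> subsemigroup_gen z = [set z; z ^2].
Proof.
move=> /collapsingP cz; apply/seteqP; split=> x /=; last first.
  by have [z1 z2 _] := subsemigroup_gen3 z; case=> ->.
case=> -[//|m] _ <-; rewrite /spow iteropS.
(* Multiplication by [z] maps [z] to [z ^2], and [z ^2] to [z ^3], which is again one of the two. *)
elim: m => [|m] /=; first by left.
by case=> ->; [right | case: cz => ->; [left | right]].
Qed.

Lemma collapsing_sqr_idempotent z : collapsing z -> idempotent z ^2.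
Proof.
by move=> /collapsingP cz; apply/eqP; rewrite -mulgA; case: cz => e; rewrite !e.
Qed.

Lemma elt_order_collapsing z :
  collapsing z -> [set Some 1; Some 2] (elt_order z).
Proof.
move=> /collapsing_gen e; rewrite /elt_order; case: pselect => /= [_|]; last first.
  by case; rewrite e; apply: finite_set2.
rewrite e fset_setU1// fset_set1 cardfs2.
by case: (_ != _); [right | left].
Qed.

(** Three distinct powers would not fit into a set of at most two elements; infinite order is
    excluded since [None] is not an allowed value. *)
Lemma collapsing_elt_order z :
  [set Some 1; Some 2] (elt_order z) -> collapsing z.
Proof.
rewrite /elt_order; case: pselect => /= [fz|_]; last by case.
move=> oz; apply/negP=> /uniq_leq_size zle.
have /zle : {subset [:: z; z ^2; z ^3] <= fset_set (subsemigroup_gen z)}.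
  have [z1 z2 z3] := subsemigroup_gen3 z.
  by move=> x; rewrite !inE => /or3P[] /eqP ->; rewrite in_fset_set // mem_set.
by case: oz => -[->].
Qed.

Lemma elt_orders_collapsing :
  elt_orders S `<=` [set Some 1; Some 2] <-> forall z, collapsing z.
Proof.
split=> [oS z|cS _ [z _ <-]]; last exact: elt_order_collapsing.
by apply: collapsing_elt_order; apply: oS; exists z.
Qed.

Lemma not_collapsing_triangle z : ~~ collapsing z ->
  [/\ enhanced_adj z z ^2, enhanced_adj z ^2 z ^3 & enhanced_adj z ^3 z].
Proof.
rewrite negbK /= !inE negb_or andbT => /andP[/andP[n12 n13] n23].
have [z1 z2 z3] := subsemigroup_gen3 z.
rewrite /enhanced_adj n12 n23 eq_sym n13.
by split; apply/asboolP; exists z.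
Qed.

Hypothesis collapsingS : forall z, collapsing z.

(** Distinct elements of [[set z; z ^2]] with [x] not idempotent force [x = z]. Hence a
    non-idempotent vertex has at most one neighbour. *)
Lemma collapsing_adj_sqr x y : enhanced_adj x y -> ~~ idempotent x -> y = x ^2.
Proof.
case/andP=> nxy /asboolP[z []]; rewrite collapsing_gen //=.
case=> ex; case=> ey; move: nxy; rewrite ex ey ?eqxx // => _.
by rewrite collapsing_sqr_idempotent.
Qed.

(** Idempotency is thus a proper 2-colouring of the graph. *)
Lemma collapsing_adj_idempotent x y :
  enhanced_adj x y -> idempotent x = ~~ idempotent y.
Proof.
case/andP=> nxy /asboolP[z []]; rewrite collapsing_gen //=.
have iz2 := collapsing_sqr_idempotent _ (collapsingS z).
have sqr_neq : z != z ^2 -> idempotent z = false by rewrite eq_sym => /negbTE.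
by case=> ex; case=> ey; move: nxy; rewrite ex ey ?eqxx ?iz2.
Qed.

Lemma collapsing_acyclic : acyclic (enhanced_power_graph S).
Proof.
case=> [|x [|y [|z s]]] [] // _ /andP[].
rewrite (cycle_path x) /= => /and4P[lx xy yz _].
rewrite !inE !negb_or -!andbA => /and5P[_ nxz _ nyz /andP[nys _]].
(* One of the adjacent vertices [x], [y] is non-idempotent, so its two neighbours on the cycle
   coincide. For [y] these are [x] and [z]. *)
have [iy|ny] := boolP (idempotent y); last first.
  case/eqP: nxz; rewrite (collapsing_adj_sqr _ _ yz ny).
  by apply: collapsing_adj_sqr ny; rewrite enhanced_adj_sym.
have nx : ~~ idempotent x by rewrite (collapsing_adj_idempotent _ _ xy) iy.
(* For [x] they are [y] and the last vertex of the cycle, so [y] would occur twice. *)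
have : y \in z :: s.
  rewrite (collapsing_adj_sqr _ _ xy nx).
  by rewrite -(collapsing_adj_sqr x (last z s)) ?mem_last // enhanced_adj_sym.
by rewrite inE (negbTE nyz) (negbTE nys).
Qed.

Lemma collapsing_bipartite : bipartite (enhanced_power_graph S).
Proof.
exists [set x | idempotent x], [set x | ~~ idempotent x]; split.
- by apply/seteqP; split=> x //= _; case: (boolP (idempotent x)); [left | right].
- by apply/seteqP; split=> x //= -[->].
- move=> x y /= ix iy; apply/negP=> /collapsing_adj_idempotent.
  by rewrite ix iy.
- move=> x y /= /negbTE nx /negbTE ny.
  by apply/negP=> /collapsing_adj_idempotent; rewrite nx ny.
Qed.

End Collapsing.

Lemma acyclic_no_triangle (V : choiceType) (G : simple_graph V) x y z :
  acyclic G -> G x y -> G y z -> G z x -> False.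
Proof.
move=> aG xy yz zx; apply: (aG [:: x; y; z]); split=> //.
have neq u v : G u v -> u != v by apply: contraTneq => ->; rewrite adj_irr.
apply/andP; split; first by rewrite /= xy yz zx.
by rewrite /= !inE negb_or neq // (eq_sym x z) neq // neq.
Qed.

Lemma bipartite_no_triangle (V : choiceType) (G : simple_graph V) x y z :
  bipartite G -> G x y -> G y z -> G z x -> False.
Proof.
case=> A [B [AB _ iA iB]] xy yz zx.
have cover u : A u \/ B u by have : [set: V] u by []; rewrite -AB.
have notA u v : G u v -> A u -> A v -> False.
  by move=> uv Au Av; have := iA _ _ Au Av; rewrite uv.
have notB u v : G u v -> B u -> B v -> False.
  by move=> uv Bu Bv; have := iB _ _ Bu Bv; rewrite uv.
(* Two of the three vertices lie on the same side. *)
by case: (cover x) (cover y) (cover z) => [Ax|Bx] [Ay|By] [Az|Bz]; eauto.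
Qed.

Theorem theorem3p8 (S : semigroupType) :
  [<-> elt_orders S `<=` [set Some 1; Some 2];
       acyclic (enhanced_power_graph S);
       bipartite (enhanced_power_graph S)].
Proof.
tfae=> [/elt_orders_collapsing|aS|bS].
- exact: collapsing_acyclic.
- apply: collapsing_bipartite => z; apply: contraT => /not_collapsing_triangle.
  by case=> *; case: (acyclic_no_triangle _ _ z (z * z)%g (z * (z * z))%g aS).
- apply/elt_orders_collapsing => z; apply: contraT => /not_collapsing_triangle.
  by case=> *; case: (bipartite_no_triangle _ _ z (z * z)%g (z * (z * z))%g bS).
Qed.
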